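(* For the unconstrained optimal trajectory $(p_i,v_i,u_i)$ of vehicle $i$ on $[t_i^0,t_i^m]$, with $u_i(t)=a_it+b_i$ and $v_i^0=v_i(t_i^0)$: (i) If $a_i<0$, the state constraint $v_i(t)-v_{max}\le 0$ is activated if $t_i^m<\dfrac{3(p_i(t_i^m)-p_i(t_i^0))}{v_i^0+2v_{max}}$. (ii) If $a_i>0$, the state constraint $v_{min}-v_i(t)\le 0$ is activated if $t_i^m>\dfrac{3(p_i(t_i^m)-p_i(t_i^0))}{v_i^0+2v_{min}}$.
   Context: A vehicle $i$ is a double integrator $\dot p_i=v_i$, $\dot v_i=u_i$, with position $p_i$, speed $v_i$ and control (acceleration) $u_i$. It enters a control zone at time $t_i^0$ and reaches the end of it at the fixed time $t_i^m>t_i^0$ (times are in $\mathbb{R}^+$). The data $t_i^0$, $p_i(t_i^0)=0$, $v_i(t_i^0)$, $t_i^m$ and $p_i(t_i^m)$ are given; the terminal speed $v_i(t_i^m)$ is not prescribed. The vehicle is to minimize $\int_{t_i^0}^{t_i^m}\tfrac12 u_i(t)^2\,dt$ subject to the dynamics, these boundary data, and the constraints $u_{min}\le u_i(t)\le u_{max}$ and $0\le v_{min}\le v_i(t)\le v_{max}$, where $u_{min},u_{max}$ are the minimum and maximum acceleration and $v_{min},v_{max}$ the minimum and maximum speed limits. The unconstrained optimal trajectory is the solution obtained when these speed and control bounds are not imposed; it has the form $u_i(t)=a_it+b_i$, $v_i(t)=\tfrac12a_it^2+b_it+c_i$, $p_i(t)=\tfrac16a_it^3+\tfrac12b_it^2+c_it+d_i$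 with real constants $a_i,b_i,c_i,d_i$. A constraint is activated by a trajectory if its bound is reached or exceeded at some time in $[t_i^0,t_i^m]$.
   Formalization: The final time in both conditions is replaced by the travel time (final minus entry time), since (ii) as written fails for a positive entry time; the two agree when the entry time is 0. The initial speed is assumed nonnegative, as the speed limits imply. *)

(* Defs.v *)
From Stdlib Require Import Reals Lra List.
From Coquelicot Require Import Coquelicot.
Open Scope R_scope.

(* Controls have finite cost (hence are bounded) and are continuous except at the
   finitely many times in [l], where the speed need not be differentiable.
   Only the restrictions of [p], [v], [u] to [t0, tm] matter. *)
Definition double_integrator (t0 tm : R) (p v u : R -> R) : Prop :=
  continuous_on (fun t => t0 <= t <= tm) p /\
  continuous_on (fun t => t0 <= t <= tm) v /\
  (forall t, t0 < t < tm -> is_derive p t (v t)) /\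
  (exists l : list R, forall t, t0 < t < tm -> ~ In t l ->
     continuous u t /\ is_derive v t (u t)) /\
  ex_RInt (fun t => / 2 * u t ^ 2) t0 tm.

Definition cost (t0 tm : R) (u : R -> R) : R :=
  RInt (fun t => / 2 * u t ^ 2) t0 tm.

(* The terminal speed [v tm] is free. *)
Definition admissible (t0 tm v0 pm : R) (p v u : R -> R) : Prop :=
  double_integrator t0 tm p v u /\ p t0 = 0 /\ v t0 = v0 /\ p tm = pm.

Definition unconstrained_optimal (t0 tm v0 pm : R) (p v u : R -> R) : Prop :=
  admissible t0 tm v0 pm p v u /\
  forall q w z : R -> R,
    admissible t0 tm v0 pm q w z -> cost t0 tm u <= cost t0 tm z.

(* The constraint is written [g t <= 0], so its bound is reached when [g t = 0]. *)
Definition activated (t0 tm : R) (g : R -> R) : Prop :=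
  exists t, t0 <= t <= tm /\ 0 <= g t.

(* Main.v *)
(** The bounds on the final speed come from the transversality condition
    [u tm = 0]. With [h t = (t - t0)^2 * (t - tm)], the trajectory [p + e * h] is
    admissible for every [e], and its cost exceeds the optimal one by
    [e * T^2 * u tm + 2 * e^2 * T^3], where [T = tm - t0]; this is nonnegative for
    all [e] only if [u tm = 0]. Integrating [u t = a * (t - tm)] twice then gives
    [3 * (p tm - p t0) = T * (v t0 + 2 * v tm)], so that each hypothesis on [T]
    compares [v tm] with the corresponding speed limit. *)

Require Import Defs.
From Stdlib Require Import Reals Lra List.
From Coquelicot Require Import Coquelicot.
Open Scope R_scope.

Lemma continuous_on_plus (D : R -> Prop) (f g : R -> R) :
  continuous_on D f -> continuous_on D g -> continuous_on D (fun t => f t + g t).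
Proof.
intros Hf Hg x Hx.
exact (filterlim_comp_2 _ _ Rplus (Hf x Hx) (Hg x Hx) (filterlim_plus (f x) (g x))).
Qed.

Lemma continuous_on_derivable (D : R -> Prop) (f : R -> R) :
  (forall x, ex_derive f x) -> continuous_on D f.
Proof.
intros Hf; apply continuous_on_forall; intros x _.
exact (ex_derive_continuous f x (Hf x)).
Qed.

(* [MVT_gen] asks for two-sided continuity at the endpoints, hence the clamping
   of the argument to [a, b]. *)
Lemma clamp_continuous (f : R -> R) (a b x : R) :
  a <= b -> continuous_on (fun t => a <= t <= b) f ->
  continuous (fun t => f (Rmax a (Rmin b t))) x.
Proof.
intros Hab Hf.
assert (Hr : forall t, a <= Rmax a (Rmin b t) <= b).
{ intros t; split; [apply Rmax_l | apply Rmax_lub; [lra | apply Rmin_l]]. }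
apply filterlim_comp with
  (G := within (fun t => a <= t <= b) (locally (Rmax a (Rmin b x)))).
2: exact (Hf _ (Hr x)).
(* Clamping is 1-Lipschitz, so the same [eps] serves before and after it. *)
intros P [eps HP]; exists eps; intros y Hy; apply HP; [|apply Hr].
change (Rabs (y - x) < eps) in Hy.
change (Rabs (Rmax a (Rmin b y) - Rmax a (Rmin b x)) < eps).
revert Hy; unfold Rmax, Rmin, Rabs.
repeat destruct Rle_dec; repeat destruct Rcase_abs; lra.
Qed.

Lemma derive_zero_const (f : R -> R) (a b : R) :
  a <= b -> continuous_on (fun t => a <= t <= b) f ->
  (forall t, a < t < b -> is_derive f t 0) -> f b = f a.
Proof.
intros Hab Hc Hd.
set (g := fun t => f (Rmax a (Rmin b t))).
assert (Hg : forall t, a <= t <= b -> g t = f t).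
{ intros t Ht; unfold g; rewrite Rmin_right, Rmax_right by lra; reflexivity. }
destruct (MVT_gen g a b (fun _ => 0)) as [c [_ Hm]].
- rewrite Rmin_left, Rmax_right by lra; intros x Hx.
  apply is_derive_ext_loc with f; [|exact (Hd x Hx)].
  (* A ball of this radius stays inside the interval, where [g] agrees with [f]. *)
  assert (He : 0 < Rmin (x - a) (b - x)) by (apply Rmin_pos; lra).
  exists (mkposreal _ He); intros y Hy.
  change (Rabs (y - x) < Rmin (x - a) (b - x)) in Hy.
  pose proof (Rmin_l (x - a) (b - x)); pose proof (Rmin_r (x - a) (b - x)).
  apply Rabs_def2 in Hy; symmetry; apply Hg; lra.
- intros x _; apply continuity_pt_filterlim.
  exact (clamp_continuous f a b x Hab Hc).
- rewrite !Hg in Hm by lra; lra.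
Qed.

(** Each exceptional time interior to the interval splits it in two; continuity at that time lets
    the constants on both sides match. *)
Lemma derive_zero_off_list_const (f : R -> R) (l : list R) :
  forall a b, a <= b -> continuous_on (fun t => a <= t <= b) f ->
  (forall t, a < t < b -> ~ In t l -> is_derive f t 0) -> f b = f a.
Proof.
induction l as [|x l IH]; intros a b Hab Hc Hd.
- apply derive_zero_const; auto.
- destruct (Rle_or_lt x a) as [Hxa|Hxa]; [|destruct (Rle_or_lt b x) as [Hbx|Hbx]].
  + apply IH; auto; intros t Ht Hl; apply Hd; auto.
    intros [E|E]; [lra | tauto].
  + apply IH; auto; intros t Ht Hl; apply Hd; auto.
    intros [E|E]; [lra | tauto].
  + transitivity (f x); apply IH; try lra.
    * apply continuous_on_subset with (2 := Hc); intros t Ht; lra.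
    * intros t Ht Hl; apply Hd; [lra|]; intros [E|E]; [lra | tauto].
    * apply continuous_on_subset with (2 := Hc); intros t Ht; lra.
    * intros t Ht Hl; apply Hd; [lra|]; intros [E|E]; [lra | tauto].
Qed.

(** Integrates the dynamics although the speed may fail to be differentiable at finitely many times:
    [f - F] has zero derivative off [l]. *)
Lemma eq_antiderivative_off_list (f F F' : R -> R) (l : list R) (a b : R) :
  a <= b -> continuous_on (fun t => a <= t <= b) f ->
  (forall t, is_derive F t (F' t)) ->
  (forall t, a < t < b -> ~ In t l -> is_derive f t (F' t)) ->
  f b - f a = F b - F a.
Proof.
intros Hab Hc HF Hf.
assert (E : f b + - F b = f a + - F a); [|lra].
apply (derive_zero_off_list_const (fun t => f t + - F t) l); auto.
- apply continuous_on_plus; [exact Hc|].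
  apply continuous_on_derivable; intros x.
  exists (- F' x); apply (is_derive_opp F x (F' x)), HF.
- intros t Ht Hl.
  replace 0 with (F' t + - F' t) by ring.
  apply (is_derive_plus f (fun t => - F t) t (F' t) (- F' t)); auto.
  apply (is_derive_opp F t (F' t)), HF.
Qed.

Lemma is_RInt_cost_affine (t0 tm a b : R) (z : R -> R) :
  t0 <= tm -> (forall t, t0 <= t <= tm -> z t = a * t + b) ->
  is_RInt (fun t => / 2 * z t ^ 2) t0 tm
    (a ^ 2 * (tm ^ 3 - t0 ^ 3) / 6 + a * b * (tm ^ 2 - t0 ^ 2) / 2
     + b ^ 2 * (tm - t0) / 2).
Proof.
intros Ht Hz.
set (F := fun t => a ^ 2 * t ^ 3 / 6 + a * b * t ^ 2 / 2 + b ^ 2 * t / 2).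
apply is_RInt_ext with (fun t => / 2 * (a * t + b) ^ 2).
{ rewrite Rmin_left, Rmax_right by lra; intros t Hx; rewrite Hz by lra; reflexivity. }
match goal with |- is_RInt _ _ _ ?I => replace I with (minus (F tm) (F t0)) end.
2: { unfold F, minus, plus, opp; simpl; field. }
apply (is_RInt_derive F (fun t => / 2 * (a * t + b) ^ 2)); intros t _.
- unfold F; auto_derive; [trivial | field].
- apply (ex_derive_continuous (fun t => / 2 * (a * t + b) ^ 2)).
  auto_derive; trivial.
Qed.

(** The cubic [h] has a double zero at [t0] and a simple one at [tm], so it preserves both positions
    and the initial speed, while its slope at [tm] moves the free terminal speed. The added terms
    are [e] times [h], [h'] and [h'']. *)
Lemma admissible_perturbation (t0 tm v0 pm a b e : R) (p v u : R -> R) :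
  t0 <= tm -> admissible t0 tm v0 pm p v u ->
  (forall t, t0 <= t <= tm -> u t = a * t + b) ->
  admissible t0 tm v0 pm
    (fun t => p t + e * ((t - t0) ^ 2 * (t - tm)))
    (fun t => v t + e * (2 * (t - t0) * (t - tm) + (t - t0) ^ 2))
    (fun t => u t + e * (6 * t - 2 * tm - 4 * t0)).
Proof.
intros Ht [[Cp [Cv [Dp [[l Dv] _]]]] [P0 [V0 Pm]]] Hu.
split; [|repeat split; [rewrite P0 | rewrite V0 | rewrite Pm]; ring].
split; [|split; [|split; [|split]]].
- apply continuous_on_plus; auto.
  apply continuous_on_derivable; intros x; auto_derive; trivial.
- apply continuous_on_plus; auto.
  apply continuous_on_derivable; intros x; auto_derive; trivial.
- intros t Hx.
  apply (is_derive_plus p (fun t => e * ((t - t0) ^ 2 * (t - tm)))); auto.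
  auto_derive; [trivial | ring].
- exists l; intros t Hx Hl; destruct (Dv t Hx Hl) as [Cu Du]; split.
  + apply (continuous_plus u (fun t => e * (6 * t - 2 * tm - 4 * t0))); auto.
    apply (ex_derive_continuous (fun t => e * (6 * t - 2 * tm - 4 * t0))).
    auto_derive; trivial.
  + apply (is_derive_plus v
      (fun t => e * (2 * (t - t0) * (t - tm) + (t - t0) ^ 2))); auto.
    auto_derive; [trivial | ring].
(* As [h''] is affine, the perturbed control is again affine and its cost is explicit. *)
- eexists; apply (is_RInt_cost_affine t0 tm (a + 6 * e) (b - e * (2 * tm + 4 * t0)));
    auto.
  intros t Hx; cbv beta; rewrite Hu by auto; ring.
Qed.

Lemma transversality (t0 tm v0 pm a b : R) (p v u : R -> R) :
  t0 < tm -> unconstrained_optimal t0 tm v0 pm p v u ->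
  (forall t, t0 <= t <= tm -> u t = a * t + b) -> a * tm + b = 0.
Proof.
intros Ht [Ha Hopt] Hu.
set (T := tm - t0); set (U := a * tm + b).
assert (HT : 0 < T) by (unfold T; lra).
(* minimizer of the cost increment [e * T^2 * U + 2 * e^2 * T^3] *)
set (e := - U / (4 * T)).
assert (Hle := Hopt _ _ _
  (admissible_perturbation t0 tm v0 pm a b e p v u (Rlt_le _ _ Ht) Ha Hu)).
unfold cost in Hle.
rewrite (is_RInt_unique _ _ _ _
  (is_RInt_cost_affine t0 tm a b u (Rlt_le _ _ Ht) Hu)) in Hle.
rewrite (is_RInt_unique _ _ _ _ (is_RInt_cost_affine t0 tm
  (a + 6 * e) (b - e * (2 * tm + 4 * t0))
  (fun t => u t + e * (6 * t - 2 * tm - 4 * t0)) (Rlt_le _ _ Ht)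
  ltac:(intros t Hx; cbv beta; rewrite Hu by auto; ring))) in Hle.
assert (Hinc : 0 <= e * T ^ 2 * U + 2 * e ^ 2 * T ^ 3).
{ apply Rminus_le_0 in Hle.
  match type of Hle with 0 <= ?X =>
    replace X with (e * T ^ 2 * U + 2 * e ^ 2 * T ^ 3) in Hle
  end.
  - exact Hle.
  - unfold T, U; field. }
(* The minimal increment is negative unless [U = 0]. *)
replace (e * T ^ 2 * U + 2 * e ^ 2 * T ^ 3) with (- (T * U ^ 2) / 8) in Hinc
  by (unfold e; field; lra).
assert (HU : T * U ^ 2 <= 0) by lra.
destruct (Req_dec U 0) as [|HU0]; auto.
pose proof (Rmult_lt_0_compat _ _ HT (pow2_gt_0 U HU0)); lra.
Qed.

Lemma optimal_travel_time (t0 tm v0 pm a b : R) (p v u : R -> R) :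
  t0 < tm -> unconstrained_optimal t0 tm v0 pm p v u ->
  (forall t, t0 <= t <= tm -> u t = a * t + b) ->
  3 * (p tm - p t0) = (tm - t0) * (v0 + 2 * v tm).
Proof.
intros Ht Hopt Hu.
assert (HU := transversality t0 tm v0 pm a b p v u Ht Hopt Hu).
destruct Hopt as [[[Cp [Cv [Dp [[l Dv] _]]]] [_ [V0 _]]] _].
assert (Hv : forall t, t0 <= t <= tm ->
  v t = v0 + a * ((t - tm) ^ 2 - (t0 - tm) ^ 2) / 2).
{ intros t Hx.
  assert (E := eq_antiderivative_off_list v (fun t => a * (t - tm) ^ 2 / 2)
    (fun t => a * t + b) l t0 t).
  rewrite <- V0.
  enough (v t - v t0 = a * (t - tm) ^ 2 / 2 - a * (t0 - tm) ^ 2 / 2) by lra.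
  apply E; [lra | | |].
  - apply continuous_on_subset with (2 := Cv); intros s Hs; lra.
  - intros s; auto_derive; [trivial|].
    replace b with (- (a * tm)) by lra; field.
  - intros s Hs Hl; rewrite <- Hu by lra; apply Dv; [lra | auto]. }
(* The position is differentiable at every interior time, hence [nil]. With [T = tm - t0], the
   displacement is [v0 * T - a * T^3 / 3] and [v tm = v0 - a * T^2 / 2]; eliminating [a] gives the
   claim. *)
assert (E := eq_antiderivative_off_list p
  (fun t => v0 * t + a * ((t - tm) ^ 3 / 3 - (t0 - tm) ^ 2 * t) / 2)
  (fun t => v0 + a * ((t - tm) ^ 2 - (t0 - tm) ^ 2) / 2) nil t0 tm).
rewrite E; [| lra | exact Cp | |].
- rewrite Hv by lra; field.
- intros t; auto_derive; [trivial | field].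
- intros t Hx _; rewrite <- Hv by lra; auto.
Qed.

Theorem theorem2 (t0 tm v0 pm vmin vmax a b : R) (p v u : R -> R)
  (ht : 0 <= t0 < tm)
  (hlim : 0 <= vmin <= vmax)
  (hv0 : 0 <= v0)
  (hopt : unconstrained_optimal t0 tm v0 pm p v u)
  (hu : forall t, t0 <= t <= tm -> u t = a * t + b) :
  (a < 0 ->
   tm - t0 < 3 * (p tm - p t0) / (v0 + 2 * vmax) ->
   activated t0 tm (fun t => v t - vmax))
  /\
  (a > 0 ->
   tm - t0 > 3 * (p tm - p t0) / (v0 + 2 * vmin) ->
   activated t0 tm (fun t => vmin - v t)).
Proof.
assert (HT : 0 < tm - t0) by lra.
rewrite (optimal_travel_time t0 tm v0 pm a b p v u) by (auto; lra).
split; intros _ H.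
- exists tm; split; [lra|].
  destruct (Req_dec (v0 + 2 * vmax) 0) as [Z|Z].
  { (* [/ 0 = 0] makes the hypothesis false *)
    rewrite Z in H; unfold Rdiv in H; rewrite Rinv_0 in H; lra. }
  (* The denominator is nonnegative by [hv0] and [hlim], and nonzero by [Z], hence positive.
     Cancelling [tm - t0] then yields [vmax < v tm]. *)
  apply (Rmult_lt_compat_r (v0 + 2 * vmax)) in H; [|lra].
  unfold Rdiv in H; rewrite Rmult_assoc, Rinv_l, Rmult_1_r in H by auto.
  apply Rmult_lt_reg_l in H; lra.
- destruct (Req_dec (v0 + 2 * vmin) 0) as [Z|Z].
  { (* [/ 0 = 0] makes the hypothesis void, but then [v t0 = vmin = 0] *)
    exists t0; split; [lra|].
    destruct hopt as [[_ [_ [V0 _]]] _]; lra. }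
  (* With a positive denominator the same cancellation yields [v tm < vmin]. *)
  exists tm; split; [lra|].
  apply (Rmult_lt_compat_r (v0 + 2 * vmin)) in H; [|lra].
  unfold Rdiv in H; rewrite Rmult_assoc, Rinv_l, Rmult_1_r in H by auto.
  apply Rmult_lt_reg_l in H; lra.
Qed.
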